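(* For each $n\in\mathbb{N}$ let $s=s(n)\in\mathbb{N}$ be a positive integer with $s=n^{o(1)}$ as $n\to\infty$. Then $$R(D_s,Q_n)\le n+\frac{\big(2+o(1)\big)n}{\log n}\qquad\text{and}\qquad R(V_s,Q_n)\le n+\frac{\big(1+o(1)\big)n}{\log n}.$$ That is, there exist functions $\varepsilon_1,\varepsilon_2\colon\mathbb{N}\to\mathbb{R}$ tending to $0$ as $n\to\infty$ (depending only on the function $s(n)$) such that for all $n\ge2$, $R(D_s,Q_n)\le n+\frac{(2+\varepsilon_1(n))n}{\log n}$ and $R(V_s,Q_n)\le n+\frac{(1+\varepsilon_2(n))n}{\log n}$.
   Context: $\mathbb{N}$ is the set of positive integers and $\log$ is the logarithm to base $2$. All asymptotic notation is with respect to $n\to\infty$; $s(n)=n^{o(1)}$ means $\log s(n)/\log n\to 0$. For $n\in\mathbb{N}$, the Boolean lattice $Q_n$ of dimension $n$ is the poset of all subsets of an $n$-element ground set ordered by inclusion. A poset $P_1$ is an induced subposet of a poset $P_2$ if $P_1\subseteq P_2$ and for all $X,Y\in P_1$, $X\le_{P_1}Y$ if and only if $X\le_{P_2}Y$. A copy of $P_1$ in $P_2$ is an induced subposet of $P_2$ isomorphic to $P_1$. A blue/red coloring of a poset $P$ is a map $P\to\{\text{blue},\text{red}\}$ coloring its elements; a copy is blue (red) if all its elements are blue (red). The poset Ramsey number $R(P,Q)$ is the smallest $N\in\mathbb{N}$ such that every blue/red coloring of $Q_N$ contains a blue copy of $P$ or a red copy of $Q$. The $s$-diamond $D_s$ is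 the poset on $s+2$ elements consisting of an antichain of size $s$, one element smaller than all other elements, and one element larger than all other elements. The $s$-fork $V_s$ is the poset on $s+1$ elements consisting of an antichain of size $s$ and one element smaller than all elements of the antichain. *)

(* Defs.v *)
From HB Require Import structures.
From mathcomp Require Import all_boot all_order all_algebra.
From mathcomp Require Import all_classical all_reals all_analysis.
Set Implicit Arguments.
Unset Strict Implicit.
Unset Printing Implicit Defensive.
Import Order.TTheory GRing.Theory Num.Theory.
Import Order.DefaultSetSubsetOrder.

Definition boolean_lattice (n : nat) := {set 'I_n}.
HB.instance Definition _ n := Finite.copy (boolean_lattice n) {set 'I_n}.
HB.instance Definition _ n :=
  Order.CTBDistrLattice.copy (boolean_lattice n) {set 'I_n}.

Lemma boolean_latticeE n (A B : boolean_lattice n) :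
  (A <= B)%O = ((A : {set 'I_n}) \subset (B : {set 'I_n})).
Proof. by []. Qed.

Inductive diamond (s : nat) := dmin | dmax | dmid of 'I_s.
Arguments dmin {s}.
Arguments dmax {s}.

Definition diamond_code s (x : diamond s) : bool + 'I_s :=
  match x with
  | dmin => inl false
  | dmax => inl true
  | dmid i => inr i
  end.
Definition diamond_decode s (u : bool + 'I_s) : diamond s :=
  match u with
  | inl false => dmin
  | inl true => dmax
  | inr i => dmid i
  end.
Lemma diamond_codeK s : cancel (@diamond_code s) (@diamond_decode s).
Proof. by case. Qed.
HB.instance Definition _ s :=
  Finite.copy (diamond s) (can_type (@diamond_codeK s)).

Definition diamond_le s (x y : diamond s) : bool :=
  match x, y with
  | dmin, _ | _, dmax => true
  | dmid i, dmid j => i == j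
  | _, _ => false
  end.
Lemma diamond_le_refl s : reflexive (@diamond_le s).
Proof. by case=> //= i; rewrite eqxx. Qed.
Lemma diamond_le_anti s : antisymmetric (@diamond_le s).
Proof. by case=> [||i] [||j] //= /andP[/eqP->]. Qed.
Lemma diamond_le_trans s : transitive (@diamond_le s).
Proof. by case=> [||i] [||j] [||k] //= /eqP->. Qed.
Fact diamond_display : Order.disp_t. Proof. exact: Order.Disp tt tt. Qed.
HB.instance Definition _ s := Order.Le_isPOrder.Build diamond_display
  (diamond s) (@diamond_le_refl s) (@diamond_le_anti s) (@diamond_le_trans s).

Inductive fork (s : nat) := fmin | fleaf of 'I_s.
Arguments fmin {s}.

Definition fork_code s (x : fork s) : option 'I_s :=
  if x is fleaf i then Some i else None.
Definition fork_decode s (u : option 'I_s) : fork s :=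
  if u is Some i then fleaf i else fmin.
Lemma fork_codeK s : cancel (@fork_code s) (@fork_decode s).
Proof. by case. Qed.
HB.instance Definition _ s := Finite.copy (fork s) (can_type (@fork_codeK s)).

Definition fork_le s (x y : fork s) : bool :=
  match x, y with
  | fmin, _ => true
  | fleaf i, fleaf j => i == j
  | _, _ => false
  end.
Lemma fork_le_refl s : reflexive (@fork_le s).
Proof. by case=> //= i; rewrite eqxx. Qed.
Lemma fork_le_anti s : antisymmetric (@fork_le s).
Proof. by case=> [|i] [|j] //= /andP[/eqP->]. Qed.
Lemma fork_le_trans s : transitive (@fork_le s).
Proof. by case=> [|i] [|j] [|k] //= /eqP->. Qed.
Fact fork_display : Order.disp_t. Proof. exact: Order.Disp tt tt. Qed.
HB.instance Definition _ s := Order.Le_isPOrder.Build fork_display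
  (fork s) (@fork_le_refl s) (@fork_le_anti s) (@fork_le_trans s).

Variant color := blue | red.

(* The subset [A] of [P2], with the order induced from [P2], is isomorphic to
   [P1]; [f] is the isomorphism, its injectivity following from antisymmetry. *)
Definition is_copy d1 d2 (P1 : finPOrderType d1) (P2 : finPOrderType d2)
    (A : {set P2}) : Prop :=
  exists2 f : P1 -> P2, {mono f : x y / (x <= y)%O} & A = [set f x | x in P1].

Definition has_mono_copy d1 d2 (P1 : finPOrderType d1) (P2 : finPOrderType d2)
    (c : P2 -> color) (k : color) : Prop :=
  exists2 A : {set P2}, is_copy P1 A & forall x, x \in A -> c x = k.

Definition ramsey_for d1 d2 (P : finPOrderType d1) (Q : finPOrderType d2)
    (N : nat) : Prop :=
  (0 < N)%N /\
  forall c : boolean_lattice N -> color,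
    has_mono_copy P c blue \/ has_mono_copy Q c red.

Lemma mono_copy_of_emb d1 d2 (P1 : finPOrderType d1) (P2 : finPOrderType d2)
    (c : P2 -> color) (k : color) (f : P1 -> P2) :
  {mono f : x y / (x <= y)%O} -> (forall x, c (f x) = k) ->
  has_mono_copy P1 c k.
Proof.
move=> fm fc; exists [set f x | x in P1]; first by exists f.
by move=> _ /imsetP[x _ ->].
Qed.

(* Over the ground set [Q + {0, .., #|Q|} * P], attach to each [q : Q] the sets
   made of the principal ideal of [q], say of size [k], all the layers below
   [k], and a principal ideal of [P] placed in layer [k]: they form a copy of
   [P].  If none of these copies is blue, choosing a red set in each of them
   gives a copy of [Q]. *)
Lemma ramsey_for_exists d1 d2 (P : finPOrderType d1) (Q : finPOrderType d2) :
  exists N, ramsey_for P Q N.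
Proof.
pose T : finType := (Q + 'I_(#|Q|.+1) * P)%type.
exists #|T|.+1; split=> // c.
pose g (t : T) : 'I_(#|T|.+1) := widen_ord (leqnSn _) (enum_rank t).
have g_inj : injective g.
  move=> x y /(congr1 val) /= exy.
  by apply: enum_rank_inj; apply: val_inj.
pose h (A : {set T}) : boolean_lattice #|T|.+1 := [set g t | t in A].
have hS A B : (h A <= h B)%O = (A \subset B).
  rewrite boolean_latticeE; apply/idP/idP; last exact: imsetS.
  move=> /fintype.subsetP AB; apply/fintype.subsetP => t tA.
  have /imsetP[u uB /g_inj ->//] := AB _ (imset_f g tA).
pose I (q : Q) : {set Q} := [set r | (r <= q)%O].
pose J (p : P) : {set P} := [set r | (r <= p)%O].
pose inF (q : Q) (Y : {set P}) (t : Q + 'I_(#|Q|.+1) * P) : bool :=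
  match t with
  | inl r => r \in I q
  | inr (i, p) => (i < #|I q|)%N || ((i == #|I q| :> nat) && (p \in Y))
  end.
pose F (q : Q) (Y : {set P}) : {set T} := [set t | inF q Y t].
have [[q qP]|noblue] :=
  pselect (exists q, forall p, c (h (F q (J p))) = blue).
  left; apply: (@mono_copy_of_emb _ _ P _ c blue
    (fun p => h (F q (J p)))) => // x y.
  rewrite hS; apply/idP/idP => [/fintype.subsetP xy|xy].
    have lt : (#|I q| < #|Q|.+1)%N by rewrite ltnS max_card.
    have := xy (inr (Ordinal lt, x)).
    by rewrite !inE /= ltnn eqxx /= !inE lexx => /(_ isT).
  apply/fintype.subsetP => -[r|[i p]]; rewrite !inE //= !inE.
  by case: ltngtP => //= _ px; exact: le_trans px xy.
right.
have red_ex q : exists p, c (h (F q (J p))) = red.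
  apply: contrapT => nred; apply: noblue; exists q => p.
  by case E: (c _) => //; case: nred; exists p.
have [w wP] := choice red_ex.
apply: (@mono_copy_of_emb _ _ Q _ c red
  (fun q => h (F q (J (w q))))) => // x y.
rewrite hS; apply/idP/idP => [/fintype.subsetP xy|xy].
  have := xy (inl x).
  by rewrite !inE /= !inE lexx => /(_ isT).
have [->//|nxy] := eqVneq x y.
have lt : (#|I x| < #|I y|)%N.
  apply: proper_card; apply/fintype.properP; split.
    by apply/fintype.subsetP => r; rewrite !inE => rx; exact: le_trans rx xy.
  exists y; rewrite !inE ?lexx //.
  by apply: contra_neqN nxy => yx; apply: le_anti; rewrite xy.
apply/fintype.subsetP => -[r|[i p]]; rewrite !inE /= ?inE.
  by move=> rx; exact: le_trans rx xy.
by case/orP => [ix|/andP[/eqP-> _]]; rewrite ?lt // (ltn_trans ix lt).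
Qed.

Definition poset_ramsey d1 d2 (P : finPOrderType d1) (Q : finPOrderType d2)
    : nat :=
  ex_minn (P := fun N => `[< ramsey_for P Q N >])
    (let: ex_intro N h := ramsey_for_exists P Q in
     ex_intro _ N (asboolT h)).

Lemma poset_ramseyP d1 d2 (P : finPOrderType d1) (Q : finPOrderType d2) :
  ramsey_for P Q (poset_ramsey P Q) /\
  forall N, ramsey_for P Q N -> (poset_ramsey P Q <= N)%N.
Proof.
rewrite /poset_ramsey; case: ex_minnP => N /asboolP hN minN.
by split=> // m /asboolP /minN.
Qed.

Local Open Scope ring_scope.

Definition log2 (R : realType) (x : R) : R := ln x / ln 2.

(* Main.v *)
Require Import Defs.
From mathcomp Require Import all_boot all_order all_algebra.
From mathcomp Require Import perm ring lra.
From mathcomp Require Import all_classical all_reals all_analysis.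
Set Implicit Arguments.
Unset Strict Implicit.
Unset Printing Implicit Defensive.
Import Order.TTheory GRing.Theory Num.Theory.
Import numFieldNormedType.Exports.

(** Both bounds come from a counting argument.  Split the ground set of the
    large lattice into a part of size [n] and a part [Y] of size [k], and fix a
    coloring without a red copy of [Q_n].

    For each linear order [p] of [Y] let [Y_0], ..., [Y_k] be its initial
    segments.  Pushing every [A : Q_n] up to a red set [A :|: Y_(l A)], with
    [l] nondecreasing, would give a red copy of [Q_n]; the only obstruction to
    such an [l] is a blue chain [X_0 :|: Y_0], ..., [X_k :|: Y_k] with
    [X_0], ..., [X_k] nondecreasing ([chain_or_labelling],
    [red_lattice_or_blue_chains]).  So each of the [k!] orders yields a blue
    chain.

    Consider the orders whose chains share the bottom [X_0], for the fork, or
    both [X_0] and [X_k], for the diamond.  Two distinct initial segments of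
    equal size [i] are incomparable, hence so are the vertices at level [i]
    above them.  If some level [0 < i < k] carries [s] distinct segments, then
    the [s] vertices there form, with the common ends, the blue fork or diamond
    ([rung_fork], [rung_diamond]).  Otherwise there are at most [s ^ k] orders
    in the class, because an order is determined by its initial segments
    ([card_perm_prefix]).  As there are [2 ^ n] (resp. [4 ^ n]) classes, the
    copy exists as soon as [a ^ n * s ^ k < k!] with [a = 2] (resp. [a = 4])
    ([perm_pigeonhole]).

    By [ln k! >= k (ln k - 1)] this inequality holds for [k] about
    [(log a + e) n / log n]: then [ln k] is close to [ln n], while [ln s] is
    negligible against [ln n] ([fact_beats]). *)

(** * Chains against monotone labellings *)

Section Ladder.
Local Open Scope order_scope.
Context (d : Order.disp_t) (T : finPOrderType d) (P : T -> nat -> bool).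

(** Some chain [y_0 <= ... <= y_i <= x] satisfies [P y_j j] for every [j]. *)
Fixpoint ladder (x : T) (i : nat) : bool :=
  [exists y, [&& y <= x, P y i & if i is j.+1 then ladder y j else true]].

Lemma ladder_le x y i : x <= y -> ladder x i -> ladder y i.
Proof.
move=> xy; case: i => [|i] /existsP[z /and3P[zx Pz lz]];
  by apply/existsP; exists z; rewrite (le_trans zx xy) Pz.
Qed.

Lemma ladder_chain x i : ladder x i ->
  exists X : nat -> T, [/\ {homo X : a b / (a <= b)%N >-> a <= b},
    forall j, X j <= x & forall j, (j <= i)%N -> P (X j) j].
Proof.
elim: i x => [|i IH] x /existsP[y /and3P[yx Py ly]].
  by exists (fun=> y); split=> // j; rewrite leqn0 => /eqP->.
have [X [homX Xy PX]] := IH y ly.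
exists (fun j => if (j <= i)%N then X j else y); split=> [a b ab|j|j ji].
- have [bi|_] := leqP b i; first by rewrite (leq_trans ab bi) homX.
  by case: ifP.
- by case: ifP => // _; exact: le_trans yx.
- have [?|ij] := leqP j i; first exact: PX.
  by have -> : j = i.+1 by apply/eqP; rewrite eqn_leq ji ij.
Qed.

(** Label [x] by the length of the longest ladder below [x].  The label is
    nondecreasing in [x], and [P] fails at [x] and its label, since otherwise
    [x] itself would extend the ladder. *)
Lemma chain_or_labelling k :
  (exists2 X : nat -> T, {homo X : a b / (a <= b)%N >-> a <= b} &
     forall j, (j <= k)%N -> P (X j) j) \/
  (exists2 l : T -> nat, {homo l : x y / x <= y >-> (x <= y)%N} &
     forall x, (l x <= k)%N /\ ~~ P x (l x)).
Proof.
have [[x lx]|nl] := pselect (exists x, ladder x k).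
  by left; have [X [homX _ PX]] := ladder_chain lx; exists X.
right.
have ex x : exists i, ~~ ladder x i.
  by exists k; apply/negP => lx; apply: nl; exists x.
exists (fun x => ex_minn (ex x)) => [x y xy|x].
  case: ex_minnP => i _ mini; case: ex_minnP => j nj _.
  by apply: mini; apply: contra nj; exact: ladder_le.
case: ex_minnP => i ni mini; split.
  by apply: mini; apply/negP => lx; apply: nl; exists x.
apply: contra ni => Px; case: i mini Px => [|i] mini Px;
  apply/existsP; exists x; rewrite lexx Px //=.
by apply: contraT => /mini; rewrite ltnn.
Qed.
End Ladder.

(** * Counting permutations by their initial segments *)

Section Prefix.
Context (k : nat).
Implicit Types (p q : 'S_k).

Definition prefix p (i : nat) : {set 'I_k} := [set p j | j : 'I_k & (j < i)%N].

Lemma prefix_homo p : {homo prefix p : i j / (i <= j)%N >-> i \subset j}.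
Proof.
move=> i j ij; apply/fintype.subsetP => _ /imsetP[a ai ->].
by apply: imset_f; move: ai; rewrite !inE => ai; exact: leq_trans ai ij.
Qed.

Lemma mem_prefix p i j : (p j \in prefix p i) = (j < i)%N.
Proof. by rewrite mem_imset ?inE //; exact: perm_inj. Qed.

Lemma card_prefix p i : (i <= k)%N -> #|prefix p i| = i.
Proof.
move=> ik; rewrite card_imset; last exact: perm_inj.
by rewrite cardsE -sum1_card (big_ord_narrow ik) sum1_card card_ord.
Qed.

Lemma prefix_sub_leq p q i j : (i <= k)%N -> (j <= k)%N ->
  prefix p i \subset prefix q j -> (i <= j)%N.
Proof. by move=> ik jk /subset_leq_card; rewrite !card_prefix. Qed.

Lemma prefix_sub_eq p q i : (i <= k)%N ->
  prefix p i \subset prefix q i -> prefix p i = prefix q i.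
Proof. by move=> ik pq; apply/eqP; rewrite eqEcard pq !card_prefix ?leqnn. Qed.

Lemma prefix0 p : prefix p 0 = finset.set0.
Proof. exact/cards0_eq/card_prefix. Qed.

Lemma prefix_all p : prefix p k = [set: 'I_k].
Proof.
by apply/eqP; rewrite eqEcard finset.subsetT card_prefix // cardsT card_ord leqnn.
Qed.

Lemma prefix_inj p q : (forall i : 'I_k, prefix p i = prefix q i) -> p = q.
Proof.
move=> pq; have {}pq i : (i <= k)%N -> prefix p i = prefix q i.
  rewrite leq_eqVlt => /predU1P[->|ik]; first by rewrite !prefix_all.
  exact: (pq (Ordinal ik)).
apply/permP => j; pose a := (q^-1)%g (p j).
have pa : p j = q a by rewrite /a permKV.
clearbody a.
have := mem_prefix p j.+1 j; rewrite pq ?ltn_ord // pa mem_prefix ltnSn ltnS => /idP aj.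
have := mem_prefix p j j; rewrite pq ?(ltnW (ltn_ord _)) // pa mem_prefix ltnn => /negbT.
rewrite -leqNgt => ja; congr (q _).
by apply: val_inj; apply/eqP; rewrite eqn_leq aj.
Qed.

(** A permutation in [Pi] is encoded by its [k] initial segments of sizes
    [0], ..., [k - 1], and each of them has at most [s] possible values; the
    segment of size [0] is always empty. *)
Lemma card_perm_prefix (Pi : {set 'S_k}) (s : nat) : (0 < s)%N ->
  (forall i, (0 < i < k)%N -> (#|[set prefix p i | p in Pi]| <= s)%N) ->
  (#|Pi| <= s ^ k)%N.
Proof.
move=> s0 hs; pose code p := [ffun i : 'I_k => prefix p i].
have codeI : injective code.
  by move=> p q /ffunP pq; apply: prefix_inj => i; have := pq i; rewrite !ffunE.
pose F (i : 'I_k) := [set prefix p i | p in Pi].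
rewrite -(card_imset _ codeI).
apply: (@leq_trans #|family (fun i => mem (F i))|).
  apply: subset_leq_card; apply/fintype.subsetP => _ /imsetP[p pPi ->].
  by apply/familyP => i; rewrite ffunE; exact: imset_f.
rewrite card_family.
have -> : (s ^ k = \prod_(i : 'I_k) s)%N by rewrite prod_nat_const card_ord.
rewrite foldrE big_map -(big_enum _ _ _ _) /= ; apply: leq_prod => i _.
have [i0|i0] := posnP i; last by apply: hs; rewrite i0 ltn_ord.
apply: leq_trans s0; rewrite -[1%N](cards1 (finset.set0 : {set 'I_k})).
apply: subset_leq_card; apply/fintype.subsetP => _ /imsetP[p _ ->].
by rewrite inE -cards_eq0 card_prefix i0.
Qed.

(** Some class of [key] has more than [s ^ k] permutations, hence more than
    [s] initial segments of some common size. *)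
Lemma perm_pigeonhole (K : finType) (key : 'S_k -> K) (s : nat) : (0 < s)%N ->
  (#|K| * s ^ k < k`!)%N ->
  exists i (f : 'I_s -> 'S_k), [/\ (0 < i < k)%N,
    forall a b, key (f a) = key (f b) & injective (fun a => prefix (f a) i)].
Proof.
move=> s0 lt_fact; apply: contrapT => no.
suff small x : (#|[set p | key p == x]| <= s ^ k)%N.
  move: lt_fact; apply/negP; rewrite -leqNgt -card_Sn.
  rewrite -sum1_card (partition_big key predT) //=.
  rewrite -sum_nat_const; apply: leq_sum => x _.
  by rewrite sum1_card -[X in (X <= _)%N]cardsE; exact: small.
apply: card_perm_prefix => // i ik; rewrite leqNgt; apply/negP => lts; apply: no.
set F := (X in #|X|) in lts; pose e (a : 'I_s) := enum_val (widen_ord (ltnW lts) a).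
have ex a : exists p, key p = x /\ prefix p i = e a.
  have /imsetP[p] := enum_valP (widen_ord (ltnW lts) a).
  by rewrite inE => /eqP kp ep; exists p.
have [f fP] := choice ex.
exists i, f; split=> // [a b|a b].
  by rewrite (fP a).1 (fP b).1.
by rewrite (fP a).2 (fP b).2 => /enum_val_inj /(congr1 val) /= /val_inj.
Qed.
End Prefix.

(** * Blue forks and diamonds from blue chains *)

Lemma card_subsets n : #|{set 'I_n}| = (2 ^ n)%N.
Proof. by rewrite -cardsT -powersetT card_powerset cardsT card_ord. Qed.

Section Join.
Context (n k : nat).
Implicit Types (A : {set 'I_n}) (B : {set 'I_k}).

Definition join_sets A B : boolean_lattice (n + k) :=
  (@lshift n k @: A) :|: (@rshift n k @: B).

Lemma join_sets_le A B A' B' :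
  (join_sets A B <= join_sets A' B')%O = (A \subset A') && (B \subset B').
Proof.
rewrite boolean_latticeE; apply/idP/andP => [/fintype.subsetP AB|[AA BB]].
  split; apply/fintype.subsetP => i iA.
    have /AB : lshift k i \in join_sets A B by rewrite inE imset_f.
    rewrite inE => /orP[/imsetP[j jA /lshift_inj->]//|/imsetP[j _ /eqP]].
    by rewrite eq_lrshift.
  have /AB : rshift n i \in join_sets A B by rewrite inE imset_f ?orbT.
  rewrite inE => /orP[/imsetP[j _ /eqP]|/imsetP[j jA /rshift_inj->]//].
  by rewrite eq_rlshift.
by apply: finset.setUSS; apply: imsetS.
Qed.

(** A nondecreasing labelling [l] with red values embeds the small lattice by
    [A |-> join_sets A (prefix p (l A))]: the first component alone reflects the
    order, and monotonicity of [l] makes the second one preserve it. *)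
Lemma red_lattice_or_blue_chains (c : boolean_lattice (n + k) -> color) :
  has_mono_copy (boolean_lattice n) c red \/
  exists X : 'S_k -> nat -> boolean_lattice n, forall p,
    {homo X p : i j / (i <= j)%N >-> (i <= j)%O} /\
    forall i, (i <= k)%N -> c (join_sets (X p i) (prefix p i)) = blue.
Proof.
have [|nored] := pselect (has_mono_copy (boolean_lattice n) c red).
  by left.
right; suff /choice[X XP] : forall p, exists X : nat -> boolean_lattice n,
    {homo X : i j / (i <= j)%N >-> (i <= j)%O} /\
    forall i, (i <= k)%N -> c (join_sets (X i) (prefix p i)) = blue.
  by exists X.
move=> p; have [[X homX PX]|[l homl redl]] := chain_or_labelling
  (fun A : boolean_lattice n => fun i =>
     `[< c (join_sets A (prefix p i)) = blue >]) k.
  by exists X; split=> // i /PX/asboolP.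
case: nored.
apply: (@mono_copy_of_emb _ _ (boolean_lattice n) (boolean_lattice (n + k)) c red
   (fun A : boolean_lattice n => join_sets A (prefix p (l A)))) => [A B|A].
  rewrite join_sets_le boolean_latticeE.
  have [AB|//] := boolP (_ \subset _).
  by rewrite prefix_homo // homl // boolean_latticeE.
by have [_ /asboolP] := redl A; case: (c _).
Qed.

Section BlueChains.
Context (X : 'S_k -> nat -> boolean_lattice n) (i s : nat) (f : 'I_s -> 'S_k).
Context (homX : forall p, {homo X p : a b / (a <= b)%N >-> (a <= b)%O}).
Context (ik : (0 < i < k)%N) (fI : injective (fun a => prefix (f a) i)).

Definition rung p j := join_sets (X p j) (prefix p j).

Lemma rung_homo p j l : (j <= l)%N -> (rung p j <= rung p l)%O.
Proof.
by move=> jl; rewrite join_sets_le -boolean_latticeE homX //= prefix_homo.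
Qed.

Lemma rung_leq p q j l : (j <= k)%N -> (l <= k)%N ->
  (rung p j <= rung q l)%O -> (j <= l)%N.
Proof. by move=> jk lk; rewrite join_sets_le => /andP[_ /prefix_sub_leq->]. Qed.

(** Comparable vertices at the same level have nested second components of
    the same size, hence equal ones, and [f] separates those. *)
Lemma rung_antichain a b : (rung (f a) i <= rung (f b) i)%O = (a == b).
Proof.
have /andP[_ /ltnW ik'] := ik.
apply/idP/eqP => [|->//]; rewrite join_sets_le => /andP[_ ab].
exact/fI/prefix_sub_eq.
Qed.

Lemma rung_fork a0 : (forall a, X (f a) 0%N = X (f a0) 0%N) ->
  {mono (fun x : fork s => match x with
         | fmin => rung (f a0) 0
         | fleaf a => rung (f a) i
         end) : x y / (x <= y)%O}.
Proof.
have /andP[i0 /ltnW ik'] := ik => bot.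
have rung0 a : rung (f a) 0 = rung (f a0) 0 by rewrite /rung bot !prefix0.
move=> [|a] [|b]; rewrite ?lexx //.
- by rewrite -(rung0 b) rung_homo.
- by apply: negbTE; apply/negP => /(rung_leq ik' (leq0n k)); rewrite leqNgt i0.
- exact: rung_antichain.
Qed.

Lemma rung_diamond a0 : (forall a, X (f a) 0%N = X (f a0) 0%N) ->
  (forall a, X (f a) k = X (f a0) k) ->
  {mono (fun x : diamond s => match x with
         | dmin => rung (f a0) 0
         | dmax => rung (f a0) k
         | dmid a => rung (f a) i
         end) : x y / (x <= y)%O}.
Proof.
have /andP[i0 ltik] := ik => bot top; have ik' := ltnW ltik.
have rung0 a : rung (f a) 0 = rung (f a0) 0 by rewrite /rung bot !prefix0.
have rungk a : rung (f a) k = rung (f a0) k by rewrite /rung top !prefix_all.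
have k0 : (0 < k)%N by exact: leq_ltn_trans ltik.
move=> [||a] [||b]; rewrite ?lexx //.
- exact: rung_homo.
- by rewrite -(rung0 b) rung_homo.
- by apply: negbTE; apply/negP => /(rung_leq (leqnn k) (leq0n k)); rewrite leqNgt k0.
- by apply: negbTE; apply/negP => /(rung_leq (leqnn k) ik'); rewrite leqNgt ltik.
- by apply: negbTE; apply/negP => /(rung_leq ik' (leq0n k)); rewrite leqNgt i0.
- by rewrite -(rungk a) rung_homo.
- exact: rung_antichain.
Qed.
End BlueChains.

(** Chains are classified by their bottom [X p 0]. *)
Lemma ramsey_for_fork s : (0 < n)%N -> (0 < s)%N -> (2 ^ n * s ^ k < k`!)%N ->
  ramsey_for (fork s) (boolean_lattice n) (n + k).
Proof.
move=> n0 s0 fact_lt; split=> [|c]; first by rewrite addn_gt0 n0.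
have [?|[X XP]] := red_lattice_or_blue_chains c; [by right|left].
have [|i [f [ik keyf fI]]] :=
  @perm_pigeonhole k {set 'I_n} (fun p => X p 0%N) s s0.
  by rewrite card_subsets.
apply: mono_copy_of_emb (rung_fork (X := X) _ ik fI (a0 := Ordinal s0) _) _ => //.
- by move=> p; case: (XP p).
- have /andP[_ /ltnW ik'] := ik.
  by case=> [|a]; apply: (XP _).2.
Qed.

(** Chains are classified by both ends, which costs a second factor [2 ^ n]. *)
Lemma ramsey_for_diamond s : (0 < n)%N -> (0 < s)%N ->
  (2 ^ (2 * n) * s ^ k < k`!)%N ->
  ramsey_for (diamond s) (boolean_lattice n) (n + k).
Proof.
move=> n0 s0 fact_lt; split=> [|c]; first by rewrite addn_gt0 n0.
have [?|[X XP]] := red_lattice_or_blue_chains c; [by right|left].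
have [|i [f [ik keyf fI]]] :=
  @perm_pigeonhole k ({set 'I_n} * {set 'I_n})%type
    (fun p => (X p 0%N, X p k)) s s0.
  by rewrite card_prod card_subsets -expnD addnn -mul2n.
apply: mono_copy_of_emb (rung_diamond (X := X) _ ik fI (a0 := Ordinal s0) _ _) _ => //.
- by move=> p; case: (XP p).
- by move=> a; case: (keyf a (Ordinal s0)).
- by move=> a; case: (keyf a (Ordinal s0)).
- have /andP[_ /ltnW ik'] := ik.
  by case=> [||a]; apply: (XP _).2.
Qed.
End Join.

(** * Asymptotics *)

Local Open Scope classical_set_scope.
Local Open Scope ring_scope.

Section Analysis.
Context (R : realType).
Implicit Types (x e d L : R).

Lemma ln2_gt0 : 0 < ln 2 :> R.
Proof. by rewrite ln_gt0 // ltr1n. Qed.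

(** In the induction step, [k * ln (1 + 1 / k) <= 1]. *)
Lemma ln_fact_ge k : k%:R * (ln k%:R - 1) <= ln (k`!)%:R :> R.
Proof.
elim: k => [|k IH]; first by rewrite mul0r fact0 ln1.
rewrite factS natrM lnM ?posrE ?ltr0n ?fact_gt0 //.
have [->|k0] := posnP k; first by rewrite fact0 ln1 mul1r addr0 lerBlDr lerDl.
have k0' : 0 < k%:R :> R by rewrite ltr0n.
have step : k%:R * (ln k.+1%:R - ln k%:R) <= 1 :> R.
  have -> : k.+1%:R = k%:R * (1 + k%:R^-1) :> R.
    by rewrite mulrDr mulr1 divff ?gt_eqF // -natr1.
  have kV : 0 < k%:R^-1 :> R by rewrite invr_gt0.
  rewrite lnM ?posrE ?addr_gt0 // addrAC subrr add0r.
  rewrite mulrC -ler_pdivlMr // div1r; apply: le_ln1Dx.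
  by apply: lt_trans kV; rewrite ltrN10.
rewrite -natr1; rewrite -natr1 in step; lra.
Qed.

Lemma quad_lt_expR x : 0 <= x -> x ^+ 2 / 2 < expR x.
Proof.
move=> x0; apply: lt_le_trans (expR_ge1Dxn 1 x0).
by rewrite ltrDr.
Qed.

(** With [L = ln n] and [c = a + e], take [k] to be the integer part of
    [B = c n / log2 n], that is [B * L = c * ln 2 * n].  Then
    [ln k >= (1 - d) L] for large [n], and with [1 <= d L] and [ln s <= d L] the
    quantity [k (ln k - 1 - ln s)] is at least [k (1 - 3 d) L].  This exceeds
    [(1 - 3 d) c ln 2 n - L], where [3 c d = e / 2], and the remaining surplus
    [(e / 2) ln 2 n] absorbs the loss [L] from rounding [B] down. *)
Lemma fact_beats (a e : R) : 0 < a -> 0 < e ->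
  exists2 d, 0 < d & \forall n \near \oo, forall s : nat, (0 < s)%N ->
    ln (s%:R : R) <= d * ln (n%:R : R) ->
    exists2 k : nat, k%:R <= (a + e) * n%:R / log2 (n%:R : R) &
      a * n%:R * ln 2 + k%:R * ln (s%:R : R) < ln ((k`!)%:R : R).
Proof.
move=> a0 e0; pose c := a + e; have c0 : 0 < c by rewrite addr_gt0.
have l2 := ln2_gt0; set l := ln (2 : R) in l2.
pose d := e / (6 * c); have d0 : 0 < d by rewrite divr_gt0 // mulr_gt0.
have cd : c * d = e / 6.
  by rewrite /d; field; rewrite gt_eqF.
have d6 : d < 1 / 6.
  rewrite -(ltr_pM2l c0) cd /c; lra.
clearbody d; exists d => //.
(* The first summand serves to get [ln k >= (1 - d) L], the second one
   [1 <= d L], the third one to absorb the rounding error. *)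
pose L0 := 4 / (c * l * d ^+ 2) + d^-1 + 4 / (e * l) + 1.
have : \forall n \near \oo, expR L0 <= n%:R :> R by exact: nbhs_infty_ger.
apply: filterS => n Ln s s0 ls.
have n0 : 0 < n%:R :> R by apply: lt_le_trans Ln; exact: expR_gt0.
have nE : n%:R = expR (ln n%:R) :> R by rewrite lnK.
rewrite [in X in _ <= X]nE ler_expR in Ln.
rewrite /log2 -/l.
move: ls Ln nE; set L := ln n%:R => ls Ln nE.
have cl0 : 0 < c * l by rewrite mulr_gt0.
have cld0 : 0 < c * l * d ^+ 2 by rewrite mulr_gt0 // exprn_gt0.
have t1 : 0 < 4 / (c * l * d ^+ 2) by rewrite divr_gt0.
have t2 : 0 < d^-1 by rewrite invr_gt0.
have t3 : 0 < 4 / (e * l) by rewrite divr_gt0 // mulr_gt0.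
have L1 : 4 <= c * l * d ^+ 2 * L.
  rewrite mulrC -ler_pdivrMr //; rewrite /L0 in Ln; lra.
have L2 : 1 <= d * L.
  rewrite mulrC -ler_pdivrMr // div1r; rewrite /L0 in Ln; lra.
have L3 : 4 <= e * l * L.
  rewrite mulrC -ler_pdivrMr ?mulr_gt0 //; rewrite /L0 in Ln; lra.
have L0' : 0 < L by rewrite /L0 in Ln; lra.
pose B := c * n%:R / (L / l); pose k := Num.truncn B.
have BE : B * L = c * l * n%:R by rewrite /B; field; rewrite gt_eqF //= gt_eqF.
have B0 : 0 <= B by apply/ltW/divr_gt0; [exact: mulr_gt0|exact: divr_gt0].
have /andP[kB Bk] := truncn_itv B0; rewrite -/k in kB Bk.
have dL := quad_lt_expR (ltW (mulr_gt0 d0 L0')).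
have nL : expR ((1 - d) * L) * expR (d * L) = n%:R.
  by rewrite -expRD nE; congr expR; ring.
have E1 : 1 <= expR ((1 - d) * L).
  by rewrite -[X in X <= _]expR0 ler_expR; apply: mulr_ge0; [ lra | exact: ltW].
set E := expR ((1 - d) * L) in nL E1.
(* The factor 2 leaves room for rounding [B] down: [B - 1 >= E]. *)
have B2 : 2 * E <= B.
  rewrite -(ler_pM2r L0') BE -nL mulrA [c * l * E]mulrC -mulrA.
  rewrite -mulrA mulrCA ler_pM2l; last lra.
  have : c * l * ((d * L) ^+ 2 / 2) <= c * l * expR (d * L).
    by rewrite ler_pM2l ?mulr_gt0 // ltW.
  apply: le_trans.
  have -> : c * l * ((d * L) ^+ 2 / 2) = c * l * d ^+ 2 * L * L / 2 by field.
  have : 4 * L <= c * l * d ^+ 2 * L * L by rewrite ler_pM2r.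
  lra.
have Ek : E <= k%:R by rewrite -natr1 in Bk; lra.
have k0 : 0 < k%:R :> R by lra.
have lk : (1 - d) * L <= ln k%:R.
  by rewrite -[X in X <= _]expRK ler_ln ?posrE ?expR_gt0.
exists k => //; apply: lt_le_trans (ln_fact_ge k).
rewrite mulrBr mulr1.
have h1 : k%:R * ((1 - 3 * d) * L) <= k%:R * (ln k%:R - 1 - ln s%:R).
  rewrite ler_pM2l //; lra.
have h2 : (B - 1) * ((1 - 3 * d) * L) < k%:R * ((1 - 3 * d) * L).
  rewrite ltr_pM2r; last by rewrite mulr_gt0 //; lra.
  by rewrite ltrBlDr natr1.
have h3 : (B - 1) * ((1 - 3 * d) * L) = (c - 3 * (c * d)) * l * n%:R - (1 - 3 * d) * L.
  have -> : (B - 1) * ((1 - 3 * d) * L) = (1 - 3 * d) * (B * L) - (1 - 3 * d) * L by ring.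
  rewrite BE; ring.
have h4 : L <= e / 2 * l * n%:R.
  have nq := quad_lt_expR (ltW L0'); rewrite -nE in nq.
  have : e / 2 * l * (L ^+ 2 / 2) <= e / 2 * l * n%:R.
    by rewrite ler_pM2l ?mulr_gt0 ?divr_gt0 // ltW.
  apply: le_trans.
  have -> : e / 2 * l * (L ^+ 2 / 2) = e * l * L * L / 4 by field.
  have : 4 * L <= e * l * L * L by rewrite ler_pM2r.
  lra.
have h5 : 0 < d * L by rewrite mulr_gt0.
rewrite h3 cd /c in h2.
have -> : a * n%:R * l = (a + e - 3 * (e / 6)) * l * n%:R - e / 2 * l * n%:R by field.
lra.
Qed.

(** Take for [eps n] the least nonnegative value making the bound true at [n];
    only the limit of [eps] then depends on the growth of [s]. *)
Lemma ramsey_bound_of_fact (a : nat) (s r : nat -> nat) : (0 < a)%N ->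
  (forall n, (0 < n)%N -> (0 < s n)%N) ->
  (fun n => log2 (s n)%:R / log2 n%:R : R) @ \oo --> (0 : R) ->
  (forall n k, (0 < n)%N -> (2 ^ (a * n) * s n ^ k < k`!)%N ->
    (r n <= n + k)%N) ->
  exists2 eps : nat -> R, eps @ \oo --> (0 : R) &
    forall n, (2 <= n)%N ->
      (r n)%:R <= n%:R + (a%:R + eps n) * n%:R / log2 (n%:R : R).
Proof.
move=> a0 s0 s_sub r_le.
have log2_gt0 n : (2 <= n)%N -> 0 < log2 (n%:R : R).
  by move=> n2; rewrite divr_gt0 ?ln2_gt0 // ln_gt0 // ltr1n.
exists (fun n => Num.max 0
    (((r n)%:R - n%:R) * log2 n%:R / n%:R - a%:R)) => [|n n2]; last first.
  have n0 : 0 < n%:R :> R by rewrite ltr0n (ltn_trans _ n2).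
  rewrite -lerBlDl ler_pdivlMr ?log2_gt0 // -ler_pdivrMr //.
  by rewrite -lerBlDl le_max lexx orbT.
apply/cvgrPdist_lt => e e0.
have [|d d0 beats] := @fact_beats a%:R (e / 2) _ (divr_gt0 e0 (ltr0Sn R 1)).
  by rewrite ltr0n.
move/cvgrPdist_lt/(_ d d0) : s_sub => s_sub.
apply: filterS3 (nbhs_infty_ge 2) s_sub beats => n n2 s_n beats.
have n0 : (0 < n)%N by apply: ltn_trans n2.
have nR : 0 < n%:R :> R by rewrite ltr0n.
have lnn : 0 < ln n%:R :> R by rewrite ln_gt0 // ltr1n.
have l2 := ln2_gt0.
have sd : ln (s n)%:R <= d * ln n%:R :> R.
  move: s_n; rewrite sub0r normrN => /(le_lt_trans (ler_norm _)).
  have -> : log2 (s n)%:R / log2 n%:R = ln (s n)%:R / ln n%:R :> R.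
    by rewrite /log2; field; rewrite !gt_eqF.
  by rewrite ltr_pdivrMr // => /ltW.
have [k kle klt] := beats (s n) (s0 n n0) sd.
have rk : (r n <= n + k)%N.
  apply: r_le => //; rewrite -(ltr_nat R) -ltr_ln ?posrE ?ltr0n ?fact_gt0 //;
    last by rewrite muln_gt0 !expn_gt0 s0.
  apply: le_lt_trans klt; rewrite natrM lnM ?posrE ?ltr0n ?expn_gt0 ?s0 //.
  by rewrite !natrX !lnXn ?ltr0n ?s0 // -natrM !mulr_natl.
rewrite sub0r normrN ger0_norm ?le_max ?lexx // gt_max e0 /=.
rewrite ltrBlDl; apply: (@le_lt_trans _ _ (a%:R + e / 2)).
  rewrite ler_pdivrMr // -ler_pdivlMr ?log2_gt0 //; apply: le_trans kle.
  by rewrite lerBlDl -natrD ler_nat.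
lra.
Qed.
End Analysis.

Theorem corollary3 (R : realType) (s : nat -> nat)
    (s_gt0 : forall n : nat, (0 < n)%N -> (0 < s n)%N)
    (s_subpoly :
      (fun n : nat => log2 (s n)%:R / log2 n%:R : R) @ \oo --> (0 : R)) :
  exists eps1 eps2 : nat -> R,
    [/\ eps1 @ \oo --> (0 : R),
        eps2 @ \oo --> (0 : R)
      & forall n : nat, (2 <= n)%N ->
          (poset_ramsey (diamond (s n)) (boolean_lattice n))%:R
            <= n%:R + (2 + eps1 n) * n%:R / log2 (n%:R : R)
       /\ (poset_ramsey (fork (s n)) (boolean_lattice n))%:R
            <= n%:R + (1 + eps2 n) * n%:R / log2 (n%:R : R)].
Proof.
have ramsey_le d1 d2 (P : finPOrderType d1) (Q : finPOrderType d2) N :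
    ramsey_for P Q N -> (poset_ramsey P Q <= N)%N.
  by move=> PQN; apply: (poset_ramseyP P Q).2.
have [//|eps1 eps1_0 bound1] := @ramsey_bound_of_fact R 2 s
  (fun n => poset_ramsey (diamond (s n)) (boolean_lattice n)) isT s_gt0 s_subpoly.
  move=> n k n0 lt_fact; apply: ramsey_le.
  by apply: ramsey_for_diamond => //; exact: s_gt0.
have [|eps2 eps2_0 bound2] := @ramsey_bound_of_fact R 1 s
  (fun n => poset_ramsey (fork (s n)) (boolean_lattice n)) isT s_gt0 s_subpoly.
  move=> n k n0; rewrite mul1n => lt_fact; apply: ramsey_le.
  by apply: ramsey_for_fork => //; exact: s_gt0.
by exists eps1, eps2; split=> // n n2; split; [exact: bound1 | exact: bound2].
Qed.
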